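(* Let $s$ be a positive integer and let $D=\coprod_{i=1}^{s}D_i$ be the disjoint union of weighted oriented gap-free bipartite graphs $D_i$ with bipartition $X_i,Y_i$, $i=1,\dots,s$, such that every edge of $D_i$ is directed from $X_i$ to $Y_i$. Let $V$ be the vertex set of $D$. If there exists an integer $t_0\ge1$ such that $\operatorname{pd}(I(D)^{t_0})=|V|-s-1$, then $\operatorname{pd}(I(D)^t)=|V|-s-1$ for every integer $t\ge t_0$.
   Context: A weighted oriented graph $D=(V(D),E(D),w)$ is a finite simple graph (the underlying graph) with an orientation of each edge and a weight function $w:V(D)\to\{1,2,3,\dots\}$; $uv\in E(D)$ denotes an edge directed from $u$ to $v$. If $V(D)=\{z_1,\dots,z_n\}$, let $S=k[z_1,\dots,z_n]$ be the polynomial ring over a field $k$; the edge ideal is $I(D)=(z_iz_j^{w(z_j)}\mid z_iz_j\in E(D))\subset S$. Standing assumptions: graphs have at least one edge and no isolated vertices; every source (vertex with only outgoing edges) has weight $1$. Two disjoint edges $uv$, $xy$ of a graph form a gap if there is no edge with one endpoint in $\{u,v\}$ and the other in $\{x,y\}$; a graph is gap-free if no two disjoint edges form a gap. An oriented graph is bipartite or gap-free if its underlying graph is. In a disjoint union the vertex sets are pairwise disjoint. $\operatorname{pd}(I)$ is the projective dimension of the ideal $I$ itself as an $S$-module. *)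

(* Defs.v *)
From HB Require Import structures.
From mathcomp Require Import all_boot all_order all_algebra.
From mathcomp Require Import boolp mpoly.

Set Implicit Arguments.
Unset Strict Implicit.
Unset Printing Implicit Defensive.

Import GRing.Theory.
Local Open Scope ring_scope.

(* [edge D u v] is a directed edge u -> v. Asymmetry rules out loops and pairs
   of opposite edges, so that the underlying graph [adj D] is simple and each
   of its edges carries exactly one direction. *)
Record wograph (V : finType) := WOGraph {
  edge : rel V;
  weight : V -> nat;
  edge_asym : forall u v, edge u v -> ~~ edge v u;
  weight_gt0 : forall v, (0 < weight v)%N
}.

Section Graphs.
Variables (V : finType) (D : wograph V).

Definition adj : rel V := fun u v => edge D u v || edge D v u.

Definition isolated (v : V) : bool := [forall u, ~~ adj u v].

Definition source (v : V) : bool := [forall u, ~~ edge D u v].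

Definition standing_assumptions : Prop :=
  [/\ exists u v, edge D u v,
      forall v, ~~ isolated v
    & forall v, source v -> weight D v = 1%N].

Definition gap (u v x y : V) : bool :=
  [&& adj u v, adj x y, [disjoint [set u; v] & [set x; y]]
    & ~~ [exists a in [set u; v], exists b in [set x; y], adj a b]].

Definition gap_free : Prop := forall u v x y, ~~ gap u v x y.

Definition bipartition (X Y : {set V}) : Prop :=
  [/\ X :|: Y = [set: V],
      [disjoint X & Y]
    & forall u v, adj u v ->
        (u \in X) && (v \in Y) || (u \in Y) && (v \in X)].

Definition directed_from_to (X Y : {set V}) : Prop :=
  forall u v, edge D u v -> u \in X /\ v \in Y.

End Graphs.

Section Coproduct.
Variables (I : finType) (V : I -> finType) (D : forall i, wograph (V i)).

Definition coprod_edge : rel {i : I & V i} :=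
  fun p q => (tag p == tag q) && edge (D (tag p)) (tagged p) (tagged_as p q).

Definition coprod_weight (p : {i : I & V i}) : nat :=
  weight (D (tag p)) (tagged p).

Lemma coprod_edge_asym p q : coprod_edge p q -> ~~ coprod_edge q p.
Proof.
rewrite /coprod_edge; case: p q => [i x] [j y] /=.
case: eqP => //= eq_ij; case: j / eq_ij y => y.
by rewrite eqxx !tagged_asE; apply: edge_asym.
Qed.

Lemma coprod_weight_gt0 p : (0 < coprod_weight p)%N.
Proof. exact: weight_gt0. Qed.

Definition coprod : wograph {i : I & V i} :=
  WOGraph coprod_edge_asym coprod_weight_gt0.

End Coproduct.

Section Ideals.
Variable R : comNzRingType.

(* Ideals of R are the submodules of R^o. *)
Definition ideal_gen (G : R -> Prop) : {pred R^o} := fun p =>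
  `[< exists2 l : seq (R * R),
        forall c, c \in l -> G c.2 & p = \sum_(c <- l) c.1 * c.2 >].

Lemma ideal_gen_submod G : submod_closed (ideal_gen G).
Proof.
split; first by apply/asboolP; exists [::] => //; rewrite big_nil.
move=> a p q /asboolP[l1 l1G ->] /asboolP[l2 l2G ->]; apply/asboolP.
exists ([seq (a * c.1, c.2) | c <- l1] ++ l2).
  by move=> c; rewrite mem_cat => /orP[/mapP[d dl ->]|/l2G//]; exact: (l1G d).
rewrite big_cat big_map /= scaler_sumr; congr (_ + _).
by apply: eq_bigr => c _; rewrite -mulrA.
Qed.

HB.instance Definition _ (G : R -> Prop) :=
  GRing.isSubmodClosed.Build R R^o (ideal_gen G) (ideal_gen_submod G).

Definition ideal_exp (I : {pred R^o}) (t : nat) : {pred R^o} :=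
  ideal_gen (fun p =>
    exists2 f : 'I_t -> R, forall i, f i \in I & p = \prod_(i < t) f i).

HB.instance Definition _ (I : {pred R^o}) (t : nat) :=
  GRing.SubmodClosed.on (ideal_exp I t).

End Ideals.

Section Submodules.
Variables (R : nzRingType) (U : lmodType R) (N : submodClosed U).

Record submodule := Submodule { submodule_val : U; _ : submodule_val \in N }.

HB.instance Definition _ := [isSub for submodule_val].
HB.instance Definition _ := [Choice of submodule by <:].
HB.instance Definition _ := [SubChoice_isSubLmodule of submodule by <:].

End Submodules.

Section ProjectiveDimension.
Variable R : nzRingType.

Definition projective (P : lmodType R) : Prop :=
  forall (M N : lmodType R) (g : {linear M -> N}) (f : {linear P -> N}),
    (forall y, exists x, g x = y) ->
    exists h : {linear P -> M}, forall x, g (h x) = f x.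

(* An exact sequence 0 -> P d -> ... -> P 1 -> P 0 -> M -> 0 with all P i
   projective, padded by zero modules above degree d. *)
Definition has_proj_resolution (M : lmodType R) (d : nat) : Prop :=
  exists (P : nat -> lmodType R) (dP : forall i, {linear P i.+1 -> P i})
         (aug : {linear P 0 -> M}),
    [/\ forall i, projective (P i),
        forall i (x : P i), (d < i)%N -> x = 0,
        forall y, exists x, aug x = y,
        forall x, aug x = 0 <-> exists y, dP 0 y = x
      & forall i x, dP i x = 0 <-> exists y, dP i.+1 y = x].

(* [projdim_is M d] means pd M = d. The zero module, whose projective dimension
   is usually set to -oo, gets 0; a nonzero module is not affected. *)
Definition projdim_is (M : lmodType R) (d : nat) : Prop :=
  has_proj_resolution M d /\ forall e, has_proj_resolution M e -> (d <= e)%N.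

End ProjectiveDimension.

Section EdgeIdeal.
Variables (k : fieldType) (V : finType).

Definition Xv (v : V) : {mpoly k[#|V|]} := 'X_(enum_rank v).

Definition edge_ideal (D : wograph V) : {pred {mpoly k[#|V|]}^o} :=
  ideal_gen (fun p =>
    exists u v, edge D u v /\ p = Xv u * Xv v ^+ weight D v).

HB.instance Definition _ (D : wograph V) :=
  GRing.SubmodClosed.on (edge_ideal D).

(* The power I(D)^t of the edge ideal, as a module over the polynomial ring. *)
Definition edge_ideal_power (D : wograph V) (t : nat) :
    lmodType {mpoly k[#|V|]} :=
  submodule (ideal_exp (edge_ideal D) t).

End EdgeIdeal.

(* Main.v *)
Require Import Defs.
From HB Require Import structures.
From mathcomp Require Import all_boot all_algebra.
From mathcomp Require Import boolp mpoly zify.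

(** Write [I] for the edge ideal and [d] for the number of vertices minus the
    number [s] of components minus one. The theorem follows from two facts:
    the projective dimension of [I ^ t] is at most [d] for every [t]
    ([pdU_power_le]), and it does not decrease with [t] ([pdU_power_descend]).
    Both rest on one combinatorial fact. In a gap-free bipartite graph
    directed from one side to the other, the neighbourhoods of the sources
    form a chain; this applies to each component here. Let [x] be a source
    with a neighbourhood of least size and [x -> y] an edge. Then a pair of
    edges [x -> v], [u -> y] can always be exchanged for [x -> y], [u -> v],
    and it follows that the colon of [I ^ t.+1] by the edge monomial of [x ->
    y] is exactly [I ^ t] ([colon_cancellable]).

    Monotonicity is then an instance of the principle that the colon by a
    variable does not increase the projective dimension of a monomial ideal
    ([pdU_colon_var]). The resolutions in question need not be graded, so this
    is not read off from Betti numbers: the colon ideal is exhibited as a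
    direct summand of an extension of the ideal by itself, through a
    Mayer-Vietoris sequence.

    For the upper bound, a monomial ideal [J] and a power [z] of a variable
    satisfy [pd J <= max (pd (J : z), pd B + 1)], where [B] is generated by
    the generators of [J] prime to [z], all others being multiples of [z]
    ([pdU_colon_delete]), again by Mayer-Vietoris. Used for [x] and then for
    the power of [y], this bounds [pd (I ^ t.+1)] by [pd (I ^ t)] and by one
    plus the projective dimensions of powers of edge ideals of graphs with one
    vertex fewer. The induction closes because the number of non-isolated
    vertices minus the number of components with an edge ([class_rank]) drops
    strictly when such a vertex is deleted.

    The homological input is limited to the behaviour of projective dimension
    in short exact sequences ([pd_le_extension], [pd_le_cokernel]) and under
    direct summands ([pd_le_retract]). *)

Set Implicit Arguments.
Unset Strict Implicit.
Unset Printing Implicit Defensive.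
Import GRing.Theory.
Local Open Scope ring_scope.

(** * Projective dimension of modules *)

Section Homological.
Variable R : nzRingType.
Implicit Types A B C M P Q : lmodType R.

Lemma linear_of A B (f : A -> B) : linear f -> exists g : {linear A -> B}, g =1 f.
Proof.
move=> f_lin.
pose g : {linear A -> B} := HB.pack f (GRing.isLinear.Build R A B *:%R f f_lin).
by exists g.
Qed.

Definition surj A B (f : A -> B) := forall y, exists x, f x = y.

Definition short_exact A B C (i : {linear A -> B}) (p : {linear B -> C}) :=
  [/\ injective i, surj p & forall b, p b = 0 <-> exists a, i a = b].

Definition ker A B (f : {linear A -> B}) : {pred A} := fun x => f x == 0.

Lemma ker_submod A B (f : {linear A -> B}) : submod_closed (ker f).
Proof.
split=> [|a x y]; rewrite ?unfold_in /ker ?linear0 ?eqxx //.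
by rewrite linearP => /eqP-> /eqP->; rewrite scaler0 addr0.
Qed.

HB.instance Definition _ A B (f : {linear A -> B}) :=
  GRing.isSubmodClosed.Build R A (ker f) (ker_submod f).

Lemma kerP A B (f : {linear A -> B}) (x : submodule (ker f)) : f (val x) = 0.
Proof. by case: x => x /= /eqP. Qed.

Lemma ker_in A B (f : {linear A -> B}) (x : A) :
  f x = 0 -> exists y : submodule (ker f), val y = x.
Proof. by move/eqP=> fx0; exists (Submodule (fx0 : x \in ker f)). Qed.

Lemma factor_inj A B Q (i : {linear A -> B}) (f : {linear Q -> B}) :
  injective i -> (forall q, exists a, i a = f q) ->
  exists g : {linear Q -> A}, forall q, i (g q) = f q.
Proof.
move=> i_inj fP; pose g q := projT1 (cid (fP q)).
have gE q : i (g q) = f q by rewrite /g; case: cid.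
have [|h hE] := @linear_of _ _ g.
  by move=> a x y; apply: i_inj; rewrite linearP !gE linearP.
by exists h => q; rewrite hE gE.
Qed.

Lemma linear_restrict A B (f : {linear A -> B}) (N : submodClosed A)
    (N' : submodClosed B) :
  (forall x, x \in N -> f x \in N') ->
  exists g : {linear submodule N -> submodule N'}, forall x, val (g x) = f (val x).
Proof.
move=> fN; apply: (factor_inj (f := f \o val)) => [|x]; first exact: val_inj.
by exists (Submodule (fN _ (valP x))).
Qed.

Lemma projective_retract P Q (i : {linear Q -> P}) (r : {linear P -> Q}) :
  cancel i r -> projective P -> projective Q.
Proof.
move=> irK P_proj M N g f g_surj.
have [h hE] := P_proj _ _ g (f \o r) g_surj.
by exists (h \o i) => x; rewrite /= hE /= irK.
Qed.

Lemma projective_zero P : (forall x : P, x = 0) -> projective P.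
Proof.
move=> P0 M N g f _; exists \0 => x /=.
by rewrite (P0 x) !linear0.
Qed.

Lemma projective_section P M (p : {linear M -> P}) :
  projective P -> surj p -> exists s : {linear P -> M}, cancel s p.
Proof. by move=> P_proj /(P_proj _ _ p idfun)[s sE]; exists s => x; apply: sE. Qed.

Lemma projective_extension A B C (i : {linear A -> B}) (p : {linear B -> C}) :
  short_exact i p -> projective A -> projective C -> projective B.
Proof.
move=> [i_inj p_surj ipE] A_proj C_proj M N g f g_surj.
have [s sK] := projective_section C_proj p_surj.
pose d : {linear B -> B} := idfun \- (s \o p).
have dE b : d b = b - s (p b) by [].
have [r rE] : exists r : {linear B -> A}, forall b, i (r b) = d b.
  by apply: factor_inj => // b; apply/ipE; rewrite dE linearB /= sK subrr.
have [h1 h1E] := A_proj _ _ g (f \o i) g_surj.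
have [h2 h2E] := C_proj _ _ g (f \o s) g_surj.
exists ((h1 \o r) \+ (h2 \o p)) => x /=.
by rewrite linearD h1E h2E /= rE dE -linearD subrK.
Qed.

Lemma linear_inl A B : exists l : {linear A -> (A * B)%type}, l =1 (fun a => (a, 0)).
Proof. by apply: linear_of => a x y; congr (_, _); rewrite /= scaler0 addr0. Qed.

Lemma prod_exact A B : exists (i : {linear A -> (A * B)%type})
  (p : {linear (A * B)%type -> B}), short_exact i p.
Proof.
have [i iE] := linear_inl A B.
exists i, snd; split; first by move=> x y; rewrite !iE => -[].
  by move=> y; exists (0, y).
move=> [a b]; split=> /= [->|[c]]; last by rewrite iE => -[_ <-].
by exists a; rewrite iE.
Qed.

(** Projective dimension at most [e], by recursion on [e] through a single
    presentation rather than through a whole resolution: extensions, cokernels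
    and retracts can then be treated by induction, one syzygy at a time. *)
Fixpoint pd_le (e : nat) (M : lmodType R) : Prop :=
  if e is e'.+1 then
    exists P (p : {linear P -> M}),
      [/\ projective P, surj p & pd_le e' (submodule (ker p))]
  else projective M.

Lemma pd_le_succ e M : pd_le e M -> pd_le e.+1 M.
Proof.
elim: e M => [|e IHe] M.
  move=> M_proj; exists M, idfun; split=> //; first by move=> y; exists y.
  by apply: projective_zero => x; apply: val_inj; rewrite linear0; apply: (kerP x).
by case=> P [p [P_proj p_surj /IHe]]; exists P, p.
Qed.

Lemma pd_le_mono e e' M : (e <= e')%N -> pd_le e M -> pd_le e' M.
Proof.
by move=> /subnK <-; elim: (e' - e)%N => // d IHd /IHd /pd_le_succ.
Qed.

Lemma pd_le_proj e M : projective M -> pd_le e M.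
Proof. exact: (@pd_le_mono 0). Qed.

(** The horseshoe lemma: projective modules mapping onto the two ends have a direct
    sum mapping onto the middle term, and the kernels form again a short exact
    sequence. *)
Lemma pd_le_extension e A B C (i : {linear A -> B}) (p : {linear B -> C}) :
  short_exact i p -> pd_le e A -> pd_le e C -> pd_le e B.
Proof.
elim: e A B C i p => [|e IHe] A B C i p ip; first exact: (projective_extension ip).
move=> [P [f [P_proj f_surj f_pd]]] [Q [g [Q_proj g_surj g_pd]]].
have [i_inj p_surj ipE] := ip.
have [h hE] := Q_proj _ _ p g p_surj.
pose u : {linear (P * Q)%type -> B} := (i \o (f \o fst)) \+ (h \o snd).
have uE z : u z = i (f z.1) + h z.2 by [].
exists (P * Q)%type, u; split.
- have [j [q jq]] := prod_exact P Q; exact: (projective_extension jq).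
- move=> b; have [y yE] := g_surj (p b).
  have [|a aE] := (ipE (b - h y)).1; first by rewrite linearB hE yE subrr.
  have [x xE] := f_surj a.
  by exists (x, y); rewrite uE /= xE aE subrK.
have pu z : p (u z) = g z.2.
  rewrite uE linearD hE /=; have -> : p (i (f z.1)) = 0 by apply/ipE; eexists.
  by rewrite add0r.
have [inl inlE] := linear_inl P Q.
have [j jE] : exists j : {linear submodule (ker f) -> submodule (ker u)},
    forall x, val (j x) = inl (val x).
  apply: linear_restrict => x /eqP fx0; apply/eqP.
  by rewrite uE inlE /= fx0 !linear0 addr0.
have [q qE] : exists q : {linear submodule (ker u) -> submodule (ker g)},
    forall x, val (q x) = (val x).2.
  by apply: linear_restrict => x /eqP ux0; apply/eqP; rewrite -pu ux0 linear0.
apply: (IHe _ _ _ j q _ f_pd g_pd).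
split.
- by move=> x y /(congr1 val); rewrite !jE !inlE => -[/val_inj].
- move=> y; have [|a aE] := (ipE (- h (val y))).1.
    by rewrite linearN hE kerP oppr0.
  have [x xE] := f_surj a.
  have [|z zE] := @ker_in _ _ u (x, val y); first by rewrite uE /= xE aE addNr.
  by exists z; apply: val_inj; rewrite qE zE.
move=> z; split=> [qz0|[x <-]]; last by apply: val_inj; rewrite qE jE inlE.
have z2 : (val z).2 = 0 by rewrite -qE qz0.
have [|x xE] := @ker_in _ _ f (val z).1.
  by apply: i_inj; move: (kerP z); rewrite uE z2 !linear0 addr0.
by exists x; apply: val_inj; rewrite jE inlE xE -z2; case: (val z).
Qed.

Lemma pd_le_prod e A B : pd_le e A -> pd_le e B -> pd_le e (A * B)%type.
Proof. by have [i [p ip]] := prod_exact A B; apply: (pd_le_extension ip). Qed.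

(** A projective module mapping onto [B] with kernel [K] also maps onto [C], and
    there the kernel is an extension of [A] by [K]. *)
Lemma pd_le_cokernel e A B C (i : {linear A -> B}) (p : {linear B -> C}) :
  short_exact i p -> pd_le e A -> pd_le e.+1 B -> pd_le e.+1 C.
Proof.
move=> [i_inj p_surj ipE] A_pd [P [f [P_proj f_surj f_pd]]].
exists P, (p \o f); split=> //.
  by move=> c; have [b <-] := p_surj c; have [x <-] := f_surj b; exists x.
have [j jE] : exists j : {linear submodule (ker f) -> submodule (ker (p \o f))},
    forall x, val (j x) = val x.
  apply: (linear_restrict (f := idfun)) => x /eqP fx0; apply/eqP.
  by rewrite /= fx0 linear0.
have [q qE] : exists q : {linear submodule (ker (p \o f)) -> A},
    forall x, i (q x) = f (val x).
  apply: (@factor_inj _ _ _ i (f \o val)) => // x.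
  by apply/ipE; apply: (kerP x).
apply: (pd_le_extension (i := j) (p := q)) f_pd A_pd; split.
- by move=> x y /(congr1 val); rewrite !jE => /val_inj.
- move=> a; have [x xE] := f_surj (i a).
  have [|y yE] := @ker_in _ _ (p \o f) x; first by rewrite /= xE; apply/ipE; exists a.
  by exists y; apply: i_inj; rewrite qE yE.
move=> y; split=> [qy0|[x <-]].
  have [|x xE] := @ker_in _ _ f (val y); first by rewrite -qE qy0 linear0.
  by exists x; apply: val_inj; rewrite jE.
by apply: i_inj; rewrite qE jE kerP linear0.
Qed.

(** Let [p : P -> M] be a surjection from a projective module. The first syzygy of
    the direct summand [A] of [M] is then the kernel of [r \o p]; it has to be
    compared with the kernel of [p], as in Schanuel's lemma. Both fit in the fibre product
    [ker d] below, of triples [(c, (a, b))] with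
    [p c = i r p a + (1 - i r) p b]: projecting to [(a, b)] presents it as an
    extension of [P * P] by [ker p], while [(c, (a, b)) |-> a - c] retracts it
    onto [ker (r \o p)], so that the induction hypothesis applies. *)
Lemma pd_le_retract e M A (i : {linear A -> M}) (r : {linear M -> A}) :
  cancel i r -> pd_le e M -> pd_le e A.
Proof.
elim: e M A i r => [|e IHe] M A i r irK; first exact: projective_retract irK.
move=> [P [p [P_proj p_surj p_pd]]].
exists P, (r \o p); split=> //.
  by move=> a; have [x xE] := p_surj (i a); exists x; rewrite /= xE irK.
pose ir : {linear M -> M} := i \o r.
pose d : {linear (P * (P * P))%type -> M} :=
  (ir \o (p \o (fst \o snd))) \+ (p \o (snd \o snd))
  \- (ir \o (p \o (snd \o snd))) \- (p \o fst).
have dE z : d z = ir (p z.2.1) + p z.2.2 - ir (p z.2.2) - p z.1 by [].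
have rd z : r (d z) = r (p z.2.1) - r (p z.1).
  by rewrite dE !(linearB, linearD) /= !irK addrK.
have [j jE] : exists j : {linear submodule (ker (r \o p)) -> submodule (ker d)},
    forall x, val (j x) = (0, (val x, 0)).
  have [|f fE] := @linear_of P (P * (P * P))%type (fun a => (0, (a, 0))).
    by move=> a x y; congr (_, (_, _)); rewrite /= scaler0 addr0.
  have [|j jE] := @linear_restrict _ _ f (ker (r \o p)) (ker d).
    move=> x /eqP /= rpx0; apply/eqP.
    by rewrite dE /= fE /= !linear0 !addr0 rpx0 linear0.
  by exists j => x; rewrite jE fE.
have [q qE] : exists q : {linear submodule (ker d) -> submodule (ker (r \o p))},
    forall z, val (q z) = (val z).2.1 - (val z).1.
  apply: (linear_restrict (f := (fst \o snd) \- fst)) => z /eqP dz0; apply/eqP.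
  by rewrite /= !linearB /= -rd dz0 linear0.
apply: (IHe (submodule (ker d)) _ j q).
  by move=> x; apply: val_inj; rewrite qE jE subr0.
have [u uE] : exists u : {linear submodule (ker p) -> submodule (ker d)},
    forall x, val (u x) = (val x, 0).
  have [f fE] := linear_inl P (P * P)%type.
  have [|u uE] := @linear_restrict _ _ f (ker p) (ker d).
    by move=> x /eqP px0; apply/eqP; rewrite dE fE /= px0 !linear0 !addr0.
  by exists u => x; rewrite uE fE.
apply: (pd_le_extension (i := u) (p := snd \o val)) p_pd _.
  split.
  - by move=> x y /(congr1 val); rewrite !uE => -[/val_inj].
  - move=> [a b]; have [c cE] := p_surj (ir (p a) + p b - ir (p b)).
    have [|z zE] := @ker_in _ _ d (c, (a, b)); first by rewrite dE /= cE subrr.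
    by exists z; rewrite /= zE.
  move=> z; split=> /= [z20|[x <-]]; last by rewrite uE.
  have [|x xE] := @ker_in _ _ p (val z).1.
    have := kerP z; rewrite dE z20 /= !linear0 !add0r.
    by move/eqP; rewrite oppr_eq0 => /eqP.
  by exists x; apply: val_inj; rewrite uE xE -z20; apply/esym/surjective_pairing.
have [j0 [q0 jq0]] := prod_exact P P.
by apply: pd_le_proj; apply: (projective_extension jq0).
Qed.

Lemma pd_le_iso e A B (f : {linear A -> B}) :
  injective f -> surj f -> pd_le e A <-> pd_le e B.
Proof.
move=> f_inj f_surj; have [g gK] := factor_inj (f := idfun) f_inj f_surj.
split; first exact: (pd_le_retract (i := g) (r := f) gK).
by apply: (pd_le_retract (i := f) (r := g)) => x; apply: f_inj; rewrite gK.
Qed.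

Lemma pd_le_fst e A B : pd_le e (A * B)%type -> pd_le e A.
Proof.
have [l lE] := linear_inl A B.
by apply: (pd_le_retract (i := l) (r := fst)) => x; rewrite lE.
Qed.

Lemma projective_regular : projective R^o.
Proof.
move=> M N g f g_surj; have [x xE] := g_surj (f (1 : R)).
have [|h hE] := @linear_of R^o M (fun a : R => a *: x).
  by move=> a b c; rewrite scalerDl scalerA.
by exists h => a; rewrite hE linearZ xE -linearZ /= /GRing.scale /= mulr1.
Qed.

Lemma has_proj_resolutionP M d : has_proj_resolution M d <-> pd_le d M.
Proof.
split; elim: d M => [|d IHd] M.
- move=> [P [dP [aug [P_proj P0 aug_surj augE _]]]].
  have aug_inj : injective aug.
    apply: raddf_inj => x /augE[y <-].
    by rewrite (P0 1%N y) // linear0.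
  exact: ((pd_le_iso 0 aug_inj aug_surj).1 (P_proj 0%N)).
- move=> [P [dP [aug [P_proj P0 aug_surj augE dPE]]]].
  exists (P 0%N), aug; split=> //; apply: IHd.
  have [f fE] : exists f : {linear P 1%N -> submodule (ker aug)},
      forall x, val (f x) = dP 0%N x.
    apply: (@factor_inj _ _ _ val (dP 0%N)) => [|x]; first exact: val_inj.
    by apply: ker_in; apply/augE; exists x.
  exists (fun i => P i.+1), (fun i => dP i.+1), f; split=> //.
  + by move=> i x ltdi; apply: P0.
  + by move=> y; have /augE[x xE] := kerP y; exists x; apply: val_inj; rewrite fE.
  + move=> x; rewrite -dPE; split=> [fx0|dx0]; first by rewrite -fE fx0 linear0.
    by apply: val_inj; rewrite fE dx0 linear0.
- move=> /= M_proj.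
  exists (fun i => if i is 0 then M else 'rV[R]_0).
  exists (fun i => \0), idfun; split=> //=.
  + by case=> [|i] //; apply: projective_zero => x; apply: thinmx0.
  + by case=> // i x _; apply: thinmx0.
  + by move=> y; exists y.
  + by move=> x; split=> [->|[]//]; exists 0.
  + by move=> i x; split=> // _; exists 0; rewrite [RHS]thinmx0.
- move=> /= [P [p [P_proj p_surj /IHd]]].
  move=> [Q [dQ [aug [Q_proj Q0 aug_surj augE dQE]]]].
  pose S i : lmodType R := if i is j.+1 then Q j else P.
  pose dS i : {linear S i.+1 -> S i} :=
    if i is j.+1 then dQ j else (val \o aug).
  exists S, dS, p; split=> //.
  + by case.
  + by case=> // i x; apply: Q0.
  + move=> x; split=> [/ker_in[y <-]|[y <-]]; last exact: kerP.
    by have [z <-] := aug_surj y; exists z.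
  + case=> [|i] x; last exact: dQE.
    split=> [/= x0|/augE]; first by apply/augE/val_inj; rewrite linear0.
    by rewrite /= => ->.
Qed.
End Homological.

(** * Projective dimension of monomial ideals *)

Section MonomialIdeals.
Variables (k : fieldType) (n : nat).
Local Notation S := {mpoly k[n]}.
Implicit Types m f : 'X_{1..n}.

(** A monomial ideal is determined by its monomials, which form a set closed under
    multiplication; all the ideal theory below takes place in the lattice of
    these sets of exponents. *)
Record upset := Upset {
  upset_mem :> pred 'X_{1..n};
  upset_up : forall m f, upset_mem m -> upset_mem (f + m)%MM
}.
Implicit Types U W I J B : upset.

Lemma upset_le U m m' : (m <= m')%MM -> U m -> U m'.
Proof. by move=> le_mm' /(upset_up (m' - m)%MM); rewrite submK. Qed.

Definition mon_ideal U : {pred S^o} := fun p => all U (msupp p).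

Lemma mon_idealP U (p : S) :
  reflect (forall m, p@_m != 0 -> U m) (p \in mon_ideal U).
Proof.
apply: (iffP allP) => pU m; first by rewrite -mcoeff_msupp; apply: pU.
by rewrite mcoeff_msupp; apply: pU.
Qed.

Lemma mon_ideal_mul U (a p : S) m :
  p \in mon_ideal U -> m \in msupp (a * p) -> U m.
Proof.
move=> /allP pU /msuppM_le /allpairsP[[f g] /= [_ /pU gU ->]].
exact: upset_up.
Qed.

Lemma mon_ideal_submod U : submod_closed (mon_ideal U).
Proof.
split; first by rewrite unfold_in /mon_ideal msupp0.
move=> a p q pU /allP qU; apply/allP => m /msuppD_le; rewrite mem_cat.
by case/orP=> [/mon_ideal_mul|/qU//]; apply.
Qed.

HB.instance Definition _ U :=
  GRing.isSubmodClosed.Build S S^o (mon_ideal U) (mon_ideal_submod U).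

Lemma mon_ideal_sum U (r : seq 'X_{1..n}) (c : 'X_{1..n} -> k)
    (g : 'X_{1..n} -> 'X_{1..n}) :
  (forall m, m \in r -> U (g m)) ->
  \sum_(m <- r) c m *: 'X_[g m] \in mon_ideal U.
Proof.
move=> rU; rewrite big_seq; apply: rpred_sum => m /rU gU.
apply/mon_idealP => f; rewrite mcoeffZ mcoeffX; case: (g m =P f) => [<- //|_].
by rewrite mulr0 eqxx.
Qed.

Definition pdU e U := pd_le e (submodule (mon_ideal U)).

Lemma submodule_iso e (N N' : submodClosed S^o) : {subset N <= N'} -> {subset N' <= N} ->
  pd_le e (submodule N) -> pd_le e (submodule N').
Proof.
move=> NN' N'N.
have [f fE] := linear_restrict (f := idfun) NN'.
apply: (pd_le_iso _ (f := f) _ _).1 => [x y /(congr1 val)|y].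
  by rewrite !fE => /val_inj.
by exists (Submodule (N'N _ (valP y))); apply: val_inj; rewrite fE.
Qed.

Lemma eq_pdU e U W : U =1 W -> pdU e U -> pdU e W.
Proof.
move=> UW; apply: submodule_iso => p /allP pU; apply/allP => m /pU;
  by rewrite /= UW.
Qed.

Lemma pdU_translate e U W f :
  (forall m, U m = W (f + m)%MM) -> (forall m, W m -> (f <= m)%MM) ->
  pdU e U <-> pdU e W.
Proof.
move=> UE WE.
have [g gE] : exists g : {linear submodule (mon_ideal U) -> submodule (mon_ideal W)},
    forall p, val (g p) = 'X_[f] * (val p : S).
  have [|mulf mulfE] := @linear_of _ S^o S^o (fun p : S^o => 'X_[f] * (p : S)).
    by move=> a x y; rewrite mulrDr mulrCA.
  have [|g gE] := @linear_restrict _ _ _ mulf (mon_ideal U) (mon_ideal W).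
    move=> p /allP pU; apply/allP => m; rewrite mulfE.
    move=> /msuppM_le /allpairsP[[m1 m2] /= []].
    by rewrite msuppX inE => /eqP-> /pU; rewrite UE => W2 ->.
  by exists g => p; rewrite gE mulfE.
apply: pd_le_iso.
  apply: raddf_inj => p gp0; have := gE p.
  rewrite gp0 linear0 => /esym/eqP; rewrite mulf_eq0 -msupp_eq0 msuppX /= => /eqP p0.
  by apply: val_inj; rewrite linear0.
move=> q.
have pU : \sum_(m <- msupp (val q : S)) (val q : S)@_m *: 'X_[m - f] \in mon_ideal U.
  apply: mon_ideal_sum => m mq; have Wm := allP (valP q) m mq.
  by rewrite UE addmC submK ?WE.
exists (Submodule pU); apply: val_inj; apply: (etrans (gE _)).
rewrite /= mulr_sumr [RHS]mpolyE.
apply: eq_big_seq => m mq; have Wm := allP (valP q) m mq.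
by rewrite -scalerAr -mpolyXD addmC submK ?WE.
Qed.

(** The sum of two monomial ideals corresponds to the union of their sets of
    monomials, because a polynomial can be cut along its support. *)
Lemma mayer_vietoris U W I J :
  (forall m, I m = U m && W m) -> (forall m, J m = U m || W m) ->
  exists (i : {linear submodule (mon_ideal I) ->
                (submodule (mon_ideal U) * submodule (mon_ideal W))%type})
         (p : {linear (submodule (mon_ideal U) * submodule (mon_ideal W))%type ->
                submodule (mon_ideal J)}), short_exact i p.
Proof.
move=> IE JE.
have sub (V V' : upset) : (forall m, V m -> V' m) ->
    exists g : {linear submodule (mon_ideal V) -> submodule (mon_ideal V')},
    forall x, val (g x) = val x.
  move=> VV'; apply: (linear_restrict (f := idfun)) => p /allP pV.
  by apply/allP => m /pV; apply: VV'.
have [|f fE] := sub I U; first by move=> m; rewrite IE => /andP[].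
have [|g gE] := sub I W; first by move=> m; rewrite IE => /andP[].
have [|f' fE'] := sub U J; first by move=> m; rewrite JE => ->.
have [|g' gE'] := sub W J; first by move=> m; rewrite JE orbC => ->.
have [|i iE] := @linear_of _ _
    (submodule (mon_ideal U) * submodule (mon_ideal W))%type (fun x => (f x, - g x)).
  by move=> a x y; congr (_, _); rewrite /= linearP // opprD scalerN.
exists i, ((f' \o fst) \+ (g' \o snd)); split.
- by move=> x y; rewrite !iE => -[/(congr1 val)]; rewrite !fE => /val_inj.
- move=> p.
  pose q := \sum_(m <- [seq m <- msupp (val p : S) | U m]) (val p : S)@_m *: 'X_[m].
  pose q' := \sum_(m <- [seq m <- msupp (val p : S) | ~~ U m]) (val p : S)@_m *: 'X_[m].
  have qU : q \in mon_ideal U.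
    by apply: mon_ideal_sum => m; rewrite mem_filter => /andP[].
  have qW : q' \in mon_ideal W.
    apply: mon_ideal_sum => m; rewrite mem_filter => /andP[/negbTE nUm].
    by move/(allP (valP p)); rewrite JE nUm.
  exists (Submodule qU, Submodule qW); apply: (@val_inj _ _ (submodule _)).
  rewrite linearD /= fE' gE' /= [RHS]mpolyE (bigID (fun m => U m)) /=.
  by rewrite /q /q' !big_filter.
move=> [x y]; split=> /= [xy0|[z]].
  have xy : val x = - val y.
    by apply/eqP; rewrite -addr_eq0 -fE' -gE' -linearD xy0 linear0.
  have xI : val x \in mon_ideal I.
    apply/allP => m mx; rewrite IE (allP (valP x)) //=.
    by apply: (allP (valP y)); rewrite -(perm_mem (msuppN _)) -xy.
  exists (Submodule xI); rewrite iE; congr (_, _); apply: val_inj.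
    by rewrite fE.
  by rewrite linearN; apply: (etrans (congr1 -%R (gE _))); rewrite /= xy opprK.
rewrite iE => -[<- <-]; apply: val_inj.
by rewrite linearD /= fE' gE' !linearN /= fE gE subrr.
Qed.

Lemma pdU_mono e e' U : (e <= e')%N -> pdU e U -> pdU e' U.
Proof. exact: pd_le_mono. Qed.

Lemma pdU_union e U W I J :
  (forall m, I m = U m && W m) -> (forall m, J m = U m || W m) ->
  pdU e I -> pdU e.+1 U -> pdU e.+1 W -> pdU e.+1 J.
Proof.
move=> IE JE I_pd U_pd W_pd; have [i [p ip]] := mayer_vietoris IE JE.
exact: (pd_le_cokernel ip I_pd (pd_le_prod U_pd W_pd)).
Qed.

(** In the Mayer-Vietoris sequence the middle term is an extension of the sum by
    the intersection, and each of the two ideals is a direct summand of it. *)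
Lemma pdU_left e U W I J :
  (forall m, I m = U m && W m) -> (forall m, J m = U m || W m) ->
  pdU e I -> pdU e J -> pdU e U.
Proof.
move=> IE JE I_pd J_pd; have [i [p ip]] := mayer_vietoris IE JE.
exact: pd_le_fst (pd_le_extension ip I_pd J_pd).
Qed.

Lemma pdU_empty U : (forall m, ~~ U m) -> pdU 0 U.
Proof.
move=> U0; apply: projective_zero => p; apply: val_inj; rewrite linear0.
apply/mpolyP => m; rewrite mcoeff0; apply/eqP; apply: contraT => pm.
by have := mon_idealP _ _ (valP p) m pm; rewrite (negbTE (U0 m)).
Qed.

Lemma pdU_full U : (forall m, U m) -> pdU 0 U.
Proof.
move=> UT; apply: ((pd_le_iso 0 (f := val) val_inj _).2 (@projective_regular S)).
move=> p; have pU : p \in mon_ideal U by apply/allP => m _; apply: UT.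
by exists (Submodule pU).
Qed.

Lemma colon_up U f m m' : U (f + m)%MM -> U (f + (m' + m))%MM.
Proof. by rewrite Monoid.mulmCA; apply: upset_up. Qed.

Definition colon U f := Upset (@colon_up U f).

Lemma shift_up U f m m' :
  (f <= m)%MM && U (m - f)%MM -> (f <= m' + m)%MM && U (m' + m - f)%MM.
Proof.
move=> /andP[fm Um].
have fm' : (f <= m' + m)%MM by rewrite (lepm_trans fm) // lem_addl.
by rewrite fm' -addmBA //; apply: upset_up.
Qed.

Definition shift U f := Upset (@shift_up U f).

Lemma multiples_in_up U f m m' :
  (f <= m)%MM && U m -> (f <= m' + m)%MM && U (m' + m)%MM.
Proof.
by move=> /andP[fm Um]; rewrite upset_up // andbT (lepm_trans fm) // lem_addl.
Qed.

Definition multiples_in U f := Upset (@multiples_in_up U f).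

Lemma pdU_shift e U f : pdU e (shift U f) <-> pdU e U.
Proof.
apply: iff_sym; apply: (@pdU_translate _ _ _ f) => m /=; last by case/andP.
by rewrite lem_addr addmC addmK.
Qed.

Lemma pdU_multiples_in e U f : pdU e (multiples_in U f) <-> pdU e (colon U f).
Proof.
apply: iff_sym; apply: (@pdU_translate _ _ _ f) => m /=; last by case/andP.
by rewrite lem_addr.
Qed.

(** Taking the colon by a variable [v] does not increase the projective dimension.
    Up to a shift, the colon of [U] is the part [A] of [U] divisible by [v].
    Let [W] consist of the monomials [m] of [U] such that [v] does not divide
    [m] or [m / v] is in [U]. Then the union of [A] and [W] is [U], and their
    intersection is [v * U], which is isomorphic to [U]; hence [A] is a direct
    summand of an extension of [U] by [U]. A higher power of a variable would
    not do in place of [v], as [W] would no longer be closed under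
    multiplication. *)
Lemma pdU_colon_var e U i : pdU e U -> pdU e (colon U U_(i)).
Proof.
move=> U_pd; apply/pdU_multiples_in.
have W_up m m' : U m && ((m i == 0%N) || U (m - U_(i))%MM) ->
    U (m' + m)%MM && (((m' + m)%MM i == 0%N) || U (m' + m - U_(i))%MM).
  case/andP=> Um mP; rewrite upset_up //=.
  case: eqP => //= /eqP; rewrite -lep1mP => ile.
  have [mi0|mi_neq0] := eqVneq (m i) 0%N.
    apply: upset_le Um; apply/mnm_lepP => j.
    rewrite mnmBE mnmDE mnm1E; case: eqP => [<-|_]; first by rewrite mi0.
    by rewrite subn0 leq_addl.
  rewrite (negbTE mi_neq0) /= in mP.
  by rewrite -addmBA ?lep1mP //; apply: upset_up.
apply: (pdU_left (W := Upset W_up) (I := shift U U_(i)) (J := U)).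
- move=> m /=; rewrite lep1mP; case: (eqVneq (m i) 0%N) => //= mi0.
  have [Um|nUm] := boolP (U m) => //=; apply: contraNF nUm.
  by apply: upset_le; apply: lem_subr.
- move=> m /=; rewrite lep1mP; case: (U m); rewrite ?andbF //=.
  by case: (m i == 0%N).
- exact/pdU_shift.
- exact: U_pd.
Qed.

(** [U] is the union of its part divisible by [f], which is a shift of the colon
    ideal, and of [B]; when divisibility by [f] does not matter for membership
    in [B], these intersect in [f * B], a copy of [B]. *)
Lemma pdU_colon_delete e U B f :
  (forall m, B m -> U m) -> (forall m, U m -> (f <= m)%MM || B m) ->
  (forall m, B (f + m)%MM -> B m) ->
  pdU e.+1 (colon U f) -> pdU e B -> pdU e.+1 U.
Proof.
move=> BU UfB fB U_pd B_pd.
apply: (pdU_union (U := multiples_in U f) (W := B) (I := shift B f)).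
- move=> m /=; case: (boolP (f <= m)%MM) => //= fm.
  apply/idP/andP => [Bm|[_ Bm]].
    by have Bm' := upset_le (lem_subr m f) Bm; split=> //; apply: BU.
  by apply: fB; rewrite addmC submK.
- move=> m /=; apply/idP/orP => [Um|[/andP[]//|/BU//]].
  by case/orP: (UfB m Um) => ->; rewrite ?Um; [left|right].
- exact/pdU_shift.
- exact/pdU_multiples_in.
- exact: pdU_mono B_pd.
Qed.

Lemma pdU_colon_only e U f :
  (forall m, U m -> (f <= m)%MM) -> pdU e (colon U f) -> pdU e U.
Proof. by move=> fU; apply: (pdU_translate _ _ _).1 => // m. Qed.

End MonomialIdeals.

(** * Powers of edge ideals as sets of exponents *)

Section EdgeMonomials.
Variables (T : finType) (w : T -> nat).
Implicit Types (E : rel T) (s : seq (T * T)) (m : 'X_{1..#|T|}).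
Local Notation rk := enum_rank.

Definition edge_mnm (e : T * T) : 'X_{1..#|T|} :=
  (U_(rk e.1) + U_(rk e.2) *+ w e.2)%MM.

Definition edges_mnm s := (\big[+%MM/0%MM]_(e <- s) edge_mnm e)%MM.

Lemma edge_mnmE e v :
  edge_mnm e (rk v) = ((e.1 == v) + (e.2 == v) * w v)%N.
Proof.
rewrite mnmDE mulmnE !mnm1E !(inj_eq enum_rank_inj).
by case: (e.2 =P v) => // ->.
Qed.

Lemma edge_mnm_addE e m v :
  (edge_mnm e + m)%MM (rk v) = ((e.1 == v) + (e.2 == v) * w v + m (rk v))%N.
Proof. by rewrite mnmDE edge_mnmE. Qed.

Lemma edges_mnm_cons e s : edges_mnm (e :: s) = (edge_mnm e + edges_mnm s)%MM.
Proof. exact: big_cons. Qed.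

Lemma edges_mnm_perm s s' : perm_eq s s' -> edges_mnm s = edges_mnm s'.
Proof. exact: perm_big. Qed.

Lemma edges_mnm_eq0 s v :
  {in s, forall e, (e.1 != v) && (e.2 != v)} -> edges_mnm s (rk v) = 0%N.
Proof.
move=> sv; rewrite /edges_mnm mnm_sumE big1_seq // => e /andP[_ es].
by rewrite edge_mnmE; case/andP: (sv e es) => /negbTE-> /negbTE->.
Qed.

Lemma lem_vertexP m m' : reflect (forall v, m (rk v) <= m' (rk v))%N (m <= m')%MM.
Proof.
apply: (iffP mnm_lepP) => [le v|le i]; first exact: le.
by rewrite -(enum_valK i).
Qed.

Definition all_edges E s := all (fun e => E e.1 e.2) s.

(** The products of [t] edge monomials are kept as lists of edges, on which the
    exchange of two edges is visible. *)
Definition has_edges E (t : nat) m :=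
  `[< exists s, [/\ size s = t, all_edges E s & (edges_mnm s <= m)%MM] >].

Lemma has_edges_up E t m m' : has_edges E t m -> has_edges E t (m' + m)%MM.
Proof.
move=> /asboolP[s [st sE sm]]; apply/asboolP; exists s; split=> //.
exact: lepm_trans sm (lem_addl _ _).
Qed.

Definition power_upset E t := Upset (@has_edges_up E t).

Lemma power_upsetP E t m :
  reflect (exists s, [/\ size s = t, all_edges E s & (edges_mnm s <= m)%MM])
          (power_upset E t m).
Proof. exact: asboolP. Qed.

Lemma power_upset_sub E E' t m :
  (forall u v, E u v -> E' u v) -> power_upset E t m -> power_upset E' t m.
Proof.
move=> EE' /power_upsetP[s [st sE sm]]; apply/power_upsetP; exists s.
by split=> //; apply: sub_all sE => e; apply: EE'.
Qed.

(** No directed path has length two: each edge joins a source to a sink. Thus the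
    exponent of a source in a product of edges counts the edges at that
    source, and that of a sink is a multiple of its weight. *)
Definition sources_to_sinks E := forall x y z, E x y -> ~~ E y z.

Lemma source_neq_sink E x y : sources_to_sinks E -> E x y -> x != y.
Proof.
move=> bip Exy; apply: contraTneq Exy => ->; apply/negP=> Eyy.
by have := bip _ _ y Eyy; rewrite Eyy.
Qed.

(** Every pair of edges [x -> v] and [u -> y] can be exchanged for [x -> y] and
    [u -> v], so that the edge [x -> y] can be cancelled from products of
    edges. *)
Definition cancellable_edge E x y :=
  E x y /\ forall u v, E u y -> E x v -> E u v.

(** The colon of the power [t.+1] of the edge ideal by a cancellable edge
    [x -> y] is the power [t]. Suppose that [m] times this edge is divisible by
    a product of [t.+1] edges. One of these can be discarded in such a way that
    the others divide [m]: an edge [x -> y] if there is one, an edge at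
    [x] or at [y] if the remaining edges avoid the other of these two vertices,
    any edge if none of them is used. In the only case left, there are edges
    [x -> v] and [u -> y], which are replaced by the single edge [u -> v]. *)
Lemma colon_cancellable E x y t m : sources_to_sinks E -> cancellable_edge E x y ->
  power_upset E t.+1 (edge_mnm (x, y) + m)%MM = power_upset E t m.
Proof.
have exchange (a b c d p q : nat) :
    (a + b + (c + d + p) <= a + d + q -> c + b + p <= q)%N by lia.
move=> bip [Exy xyP]; apply/power_upsetP/power_upsetP; last first.
  move=> [s [st sE sm]]; exists ((x, y) :: s).
  rewrite /= st Exy sE edges_mnm_cons; split=> //.
  by apply/mnm_lepP=> i; rewrite !mnmDE leq_add2l; apply: (mnm_lepP sm).
move=> [s [st sE sm]].
have neqxy := source_neq_sink bip Exy.
have x_src e : E e.1 e.2 -> e.2 != x.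
  by move=> Ee; apply: contraTneq Ee => ->; apply/negP=> /(bip _ _ y); rewrite Exy.
have y_tgt e : E e.1 e.2 -> e.1 != y.
  by move=> Ee; apply: contraTneq Ee => ->; apply: bip Exy.
(* The hypotheses say that discarding [e] takes care of both [x] and [y]: either
   [e] removes the factor contributed by the edge [x -> y], or the exponent in
   the product of the remaining edges is zero. *)
have drop e s1 : perm_eq s (e :: s1) ->
    (e.1 = x \/ {in s1, forall e, e.1 != x}) ->
    (e.2 = y \/ {in s1, forall e, e.2 != y}) ->
    exists s', [/\ size s' = t, all_edges E s' & (edges_mnm s' <= m)%MM].
  move=> ss1 ex ey; exists s1.
  have /= /andP[Ee s1E] : all_edges E (e :: s1) by rewrite /all_edges -(perm_all _ ss1).
  split=> //; first by apply: succn_inj; rewrite -st (perm_size ss1).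
  have s1e d : d \in s1 -> E d.1 d.2 by move/(allP s1E).
  apply/lem_vertexP => v; have /lem_vertexP/(_ v) := sm.
  rewrite (edges_mnm_perm ss1) edges_mnm_cons !edge_mnm_addE /=.
  have [<-|nxv] := eqVneq x v.
    case: ex => [->|s1x _]; first rewrite eqxx [y == x]eq_sym (negbTE neqxy).
      by rewrite -!addnA leq_add2l mul0n; apply: leq_trans (leq_addl _ _).
    by rewrite edges_mnm_eq0 // => d ds; rewrite s1x // x_src // s1e.
  have [<-|nyv] := eqVneq y v; last first.
    by rewrite /= add0n; apply: leq_trans (leq_addl _ _).
  case: ey => [->|s1y _].
    by rewrite eqxx add0n -addnA addnCA leq_add2l; apply: leq_trans (leq_addl _ _).
  by rewrite edges_mnm_eq0 // => d ds; rewrite s1y // y_tgt // s1e.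
have [/hasP[[a v] es /= /eqP ax]|nsx] := boolP (has (fun e => e.1 == x) s).
  rewrite {a}ax in es; have ss1 := perm_to_rem es; set s1 := rem _ _ in ss1.
  have [vy|nvy] := eqVneq v y; first by apply: (drop _ _ ss1); left.
  have [/hasP[[u b] es1 /= /eqP by_]|ns1y] :=
    boolP (has (fun e => e.2 == y) s1); last first.
    apply: (drop _ _ ss1); first by left.
    by right=> d ds; apply: contra ns1y => dy; apply/hasP; exists d.
  rewrite {b}by_ in es1; have ss2 := perm_to_rem es1; set s2 := rem _ _ in ss2.
  have ss : perm_eq s [:: (x, v), (u, y) & s2].
    by rewrite (perm_trans ss1) // perm_cons.
  have /= /and3P[Exv Euy s2E] : all_edges E [:: (x, v), (u, y) & s2].
    by rewrite /all_edges -(perm_all _ ss).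
  exists ((u, v) :: s2); rewrite /= s2E xyP //; split=> //.
    by apply: succn_inj; rewrite -st (perm_size ss).
  move: sm; rewrite (edges_mnm_perm ss) !edges_mnm_cons => /lem_vertexP sm.
  apply/lem_vertexP => z; have := sm z.
  by rewrite !edge_mnm_addE /=; apply: exchange.
have s_x : {in s, forall e, e.1 != x}.
  by move=> d ds; apply: contra nsx => dx; apply/hasP; exists d.
have [/hasP[e es /eqP ey]|nsy] := boolP (has (fun e => e.2 == y) s).
  have ss1 := perm_to_rem es; apply: (drop _ _ ss1); last by left.
  by right=> d /mem_rem; apply: s_x.
case: s st {sE sm} drop s_x nsx nsy => //= e s _ drop s_x _ nsy.
apply: (drop e s) => //; right=> d ds; first by apply: s_x; rewrite inE ds orbT.
by apply: contra nsy => dy; apply/orP; right; apply/hasP; exists d.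
Qed.

Definition del_vertex E v : rel T := fun a b => [&& a != v, b != v & E a b].

Lemma power_upset_del E t v c m :
  (forall a b, E a b -> (a == v) || (b == v) -> (c <= edge_mnm (a, b) (rk v))%N) ->
  power_upset E t m ->
  (U_(rk v) *+ c <= m)%MM || power_upset (del_vertex E v) t m.
Proof.
move=> cE /power_upsetP[s [st sE sm]].
have [/hasP[[a b] es /= ev]|nsv] :=
  boolP (has (fun e => (e.1 == v) || (e.2 == v)) s).
  apply/orP; left; apply: lepm_trans sm.
  rewrite (edges_mnm_perm (perm_to_rem es)) edges_mnm_cons.
  apply/lem_vertexP => z; rewrite mulmnE mnm1E (inj_eq enum_rank_inj) mnmDE.
  case: eqP => [<-|//]; rewrite mul1n (leq_trans (cE a b _ _)) ?leq_addr //.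
  exact: (allP sE _ es).
apply/orP; right; apply/power_upsetP; exists s; split=> //.
apply/allP => e es; rewrite /del_vertex (allP sE _ es) andbT -negb_or.
by apply: contra nsv => ev; apply/hasP; exists e.
Qed.

Lemma power_upset_del_free E t v c m :
  power_upset (del_vertex E v) t (U_(rk v) *+ c + m)%MM ->
  power_upset (del_vertex E v) t m.
Proof.
move=> /power_upsetP[s [st sE /lem_vertexP sm]].
apply/power_upsetP; exists s; split=> //; apply/lem_vertexP => z.
have := sm z; rewrite mnmDE mulmnE mnm1E (inj_eq enum_rank_inj).
case: eqP => [<- _|//]; rewrite edges_mnm_eq0 // => e es.
by have /and3P[-> ->] := allP sE _ es.
Qed.

End EdgeMonomials.

(** * The rank and the chain condition *)

Section Rank.
Variables (T I : finType) (L : T -> I).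
Implicit Type E : rel T.

Definition touched E v := [exists u, E u v || E v u].

Definition touched_class E c := [set v | (L v == c) && touched E v].

(** When the classes of [L] with at least one edge are connected up to isolated
    vertices, this is the number of edges of a spanning forest. *)
Definition class_rank E := (\sum_c #|touched_class E c|.-1)%N.

Definition within_classes E := forall x y, E x y -> L x = L y.

(** Truncation at zero does not spoil strictness, since the class of [v] also
    contains a neighbour of [v]. *)
Lemma class_rank_del E v : sources_to_sinks E -> within_classes E -> touched E v ->
  (class_rank (del_vertex E v) < class_rank E)%N.
Proof.
move=> bip lab vt.
have sub c : touched_class (del_vertex E v) c \subset touched_class E c :\ v.
  apply/subsetP => z; rewrite !inE => /andP[-> /existsP[u uz]] /=.
  apply/andP; split; last first.
    by apply/existsP; exists u; case/orP: uz => /and3P[_ _ ->]; rewrite ?orbT.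
  by case/orP: uz => /and3P[].
have [u Lu uv] : exists2 u, L u = L v & (u != v) && touched E u.
  have irr a b := @source_neq_sink _ E a b bip.
  have /existsP[u /orP[Euv|Evu]] := vt; exists u;
    rewrite ?(lab _ _ Euv) ?(lab _ _ Evu) //.
    by rewrite irr //; apply/existsP; exists v; rewrite Euv orbT.
  by rewrite eq_sym irr //; apply/existsP; exists v; rewrite Evu.
rewrite /class_rank (bigD1 (L v)) //= [ltnRHS](bigD1 (L v)) //=.
have vC : v \in touched_class E (L v) by rewrite inE eqxx.
have uC : u \in touched_class E (L v) :\ v.
  by case/andP: uv => nuv ut; rewrite !inE nuv Lu eqxx.
rewrite -addSn leq_add //.
  have := subset_leq_card (sub (L v)); rewrite (cardsD1 v (touched_class E _)) vC.
  have : (0 < #|touched_class E (L v) :\ v|)%N by apply/card_gt0P; exists u.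
  lia.
apply: leq_sum => c _.
have := subset_leq_card (sub c).
have := subset_leq_card (subD1set (touched_class E c) v); lia.
Qed.

Lemma class_rank_gt0 E x y : sources_to_sinks E -> within_classes E -> E x y ->
  (0 < class_rank E)%N.
Proof.
move=> bip lab Exy; apply: leq_ltn_trans (class_rank_del (v := x) bip lab _) => //.
by apply/existsP; exists y; rewrite Exy orbT.
Qed.

(** Within a class, the neighbourhoods of the sources form a chain: this is the
    form in which gap-freeness is used. *)
Definition nested E := forall x y u v,
  E x y -> E u v -> L x = L u -> E x v || E u y.

(** Take [x] with a nonempty neighbourhood of least cardinality, and any neighbour
    [y]: by nestedness, the neighbourhood of [x] is contained in that of every
    other neighbour of [y]. *)
Lemma cancellable_edge_exists E x0 y0 : within_classes E -> nested E -> E x0 y0 ->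
  exists x y, cancellable_edge E x y.
Proof.
move=> lab nest Exy0.
have P0 : [exists y, E x0 y] by apply/existsP; exists y0.
have [x /existsP[y Exy] xmin] :=
  arg_minnP (P := fun x => [exists y, E x y]) (fun x => #|[set v | E x v]|) P0.
exists x, y; split=> // u v Euy Exv; apply: contraT => nEuv.
have Lxu : L x = L u by rewrite (lab _ _ Exy) (lab _ _ Euy).
have Pu : [exists y, E u y] by apply/existsP; exists y.
have := xmin u Pu; rewrite leqNgt => /negP[]; apply/proper_card/properP; split.
  apply/subsetP => z; rewrite !inE => Euz.
  by have := nest _ _ _ _ Exv Euz Lxu; rewrite (negbTE nEuv) orbF.
by exists v; rewrite !inE.
Qed.

Lemma del_sources_to_sinks E v : sources_to_sinks E -> sources_to_sinks (del_vertex E v).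
Proof.
move=> bip x y z /and3P[_ _ Exy].
by rewrite /del_vertex (negbTE (bip _ _ z Exy)) !andbF.
Qed.

Lemma del_within_classes E v : within_classes E -> within_classes (del_vertex E v).
Proof. by move=> lab x y /and3P[_ _ /lab]. Qed.

Lemma del_nested E v : nested E -> nested (del_vertex E v).
Proof.
move=> nest x y a b /and3P[xv yv Exy] /and3P[av bv Eab] Lxa.
by rewrite /del_vertex xv yv av bv /=; apply: nest.
Qed.

End Rank.

(** * Projective dimension of powers of edge ideals *)

Section ProjDim.
Variables (k : fieldType) (T I : finType) (L : T -> I) (w : T -> nat).
Local Notation rk := enum_rank.
Local Notation PU := (power_upset w).
Local Notation pdU := (pdU k).
Implicit Type E : rel T.

Lemma pdU_colon_power e (U : upset #|T|) i c :
  pdU e U -> pdU e (colon U (U_(i) *+ c)%MM).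
Proof.
elim: c => [|c IHc]; first by apply: eq_pdU => m /=; rewrite add0m.
move/IHc/(pdU_colon_var i); apply: eq_pdU => m /=.
by rewrite mulmSr addmA.
Qed.

(** The smaller power is the colon of the larger one by a cancellable edge, that
    is, an iterated colon by variables. *)
Lemma pdU_power_descend E e t x y : sources_to_sinks E -> cancellable_edge E x y ->
  pdU e (PU E t.+1) -> pdU e (PU E t).
Proof.
move=> bip rev /(pdU_colon_var (rk x)) /(pdU_colon_power (rk y) (w y)).
by apply: eq_pdU => m /=; rewrite addmA; apply: colon_cancellable.
Qed.

(** Induction on the rank, then on [t]. For a cancellable edge [x -> y], the colon
    by [x] and then by the power of [y] in the edge monomial turns the power
    [t.+1] of the ideal into the power [t]. The two correction terms are powers
    of the edge ideals of the graph without [x] and without [y], the latter up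
    to a colon by [x]; they may be one worse in projective dimension, and
    indeed deleting a vertex lowers the rank. *)
Lemma pdU_power_le E t : (forall v, 0 < w v)%N ->
  sources_to_sinks E -> within_classes L E -> nested L E ->
  pdU (class_rank L E).-1 (PU E t).
Proof.
have [N leN] := ubnP (class_rank L E); elim: N => // N IHN in E leN t *.
move=> w_gt0 bip lab nest.
elim: t => [|t IHt].
  apply: (pdU_mono (leq0n _)); apply: pdU_full => m; apply/power_upsetP; exists [::].
  by split=> //; rewrite /edges_mnm big_nil; apply/mnm_lepP => i; rewrite mnm0E.
have empty E' : sources_to_sinks E' -> within_classes L E' -> class_rank L E' = 0%N ->
    forall m, ~~ PU E' t.+1 m.
  move=> bip' lab' r0 m; apply/power_upsetP => -[[|[a b] s] [//= _ /andP[/= Eab _] _]].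
  by have := class_rank_gt0 bip' lab' Eab; rewrite r0.
have [r0|r_gt0] := posnP (class_rank L E).
  by apply: (pdU_mono (leq0n _)); apply: pdU_empty; apply: empty.
have [x0 [y0 Exy0]] : exists x y, E x y.
  apply: contraPP r_gt0 => nE.
  suff -> : class_rank L E = 0%N by [].
  apply: big1 => c _; apply/eqP; rewrite -subn1 subn_eq0 (leq_trans _ (leq0n _)) //.
  rewrite leqn0 cards_eq0 -subset0; apply/subsetP => v.
  rewrite inE => /andP[_ /existsP[u uv]].
  by case: nE; case/orP: uv => Euv; [exists u, v|exists v, u].
have [x [y rev]] := cancellable_edge_exists lab nest Exy0.
have [Exy _] := rev.
have neqxy := source_neq_sink bip Exy.
(* Each deletion leaves either a smaller bound, with room for the increase by one,
   or no edge at all, so that there is no correction term. *)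
have del v : touched E v ->
    (forall m, ~~ PU (del_vertex E v) t.+1 m) \/
    exists2 e, (class_rank L E).-1 = e.+1 & pdU e (PU (del_vertex E v) t.+1).
  move=> vt; have ltr := class_rank_del bip lab vt.
  have [r0|r'_gt0] := posnP (class_rank L (del_vertex E v)).
    by left; apply: empty r0; [apply: del_sources_to_sinks|apply: del_within_classes].
  right; exists (class_rank L E).-2; first by move: ltr r'_gt0; lia.
  apply: (@pdU_mono _ _ (class_rank L (del_vertex E v)).-1); first by move: ltr; lia.
  by apply: IHN => //; [exact: leq_trans ltr _|exact: del_sources_to_sinks
    |exact: del_within_classes|exact: del_nested].
have step (U B : upset #|T|) f : (forall m, B m -> U m) ->
    (forall m, U m -> (f <= m)%MM || B m) -> (forall m, B (f + m)%MM -> B m) ->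
    (forall m, ~~ B m) \/ (exists2 e, (class_rank L E).-1 = e.+1 & pdU e B) ->
    pdU (class_rank L E).-1 (colon U f) -> pdU (class_rank L E).-1 U.
  move=> BU UfB fB [B0|[e -> B_pd]] U_pd; last first.
    exact: pdU_colon_delete BU UfB fB U_pd B_pd.
  by apply: pdU_colon_only U_pd => m /UfB; rewrite (negbTE (B0 m)) orbF.
have sub v m : PU (del_vertex E v) t.+1 m -> PU E t.+1 m.
  by apply: power_upset_sub => a b /and3P[].
apply: (step _ (PU (del_vertex E x) t.+1) (U_(rk x))%MM) => //.
- exact: sub.
- move=> m; apply: (power_upset_del (c := 1)) => a b Eab abx.
  by rewrite edge_mnmE /=; case/orP: abx => -> //; rewrite mul1n addn_gt0 w_gt0 orbT.
- by move=> m; apply: (power_upset_del_free (c := 1)).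
- by apply: del; apply/existsP; exists y; rewrite Exy orbT.
apply: (step _ (colon (PU (del_vertex E y) t.+1) U_(rk x)%MM) (U_(rk y) *+ w y)%MM) => /=.
- by move=> m; apply: sub.
- move=> m /(power_upset_del (v := y) (c := w y)) /orP[].
  + move=> a b Eab aby; rewrite edge_mnmE /=.
    suff -> : b == y by rewrite mul1n leq_addl.
    case/orP: aby => // /eqP ay; by have := bip _ _ b Exy; rewrite -ay Eab.
  + move=> /lem_vertexP le; apply/orP; left; apply/lem_vertexP => z.
    have := le z; rewrite mnmDE !mulmnE !mnm1E !(inj_eq enum_rank_inj).
    by case: (y =P z) => // <-; rewrite (negbTE neqxy).
  + by move=> Bm; apply/orP; right.
- move=> m; rewrite Monoid.mulmCA; apply: power_upset_del_free.
- have yt : touched E y by apply/existsP; exists x; rewrite Exy.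
  have [B0|[e eE B_pd]] := del y yt; [left=> m; exact: B0|right].
  by exists e => //; apply: pdU_colon_var.
by apply: eq_pdU IHt => m /=; rewrite addmA; apply/esym/colon_cancellable.
Qed.

End ProjDim.

(** * From weighted oriented graphs to exponents *)

Lemma submod_mull (R : comNzRingType) (N : submodClosed R^o) (a p : R) :
  p \in N -> a * p \in N.
Proof. exact: (@rpredZ R R^o N a p). Qed.

Section Bridge.
Variables (k : fieldType) (T : finType) (D : wograph T).
Local Notation S := {mpoly k[#|T|]}.
Local Notation PU := (power_upset (weight D) (edge D)).

Lemma Xv_edge u v : Xv k u * Xv k v ^+ weight D v = 'X_[edge_mnm (weight D) (u, v)].
Proof. by rewrite /Xv mpolyXn -mpolyXD. Qed.

Lemma mpolyX_edges s :
  'X_[edges_mnm (weight D) s] = \prod_(e <- s) 'X_[edge_mnm (weight D) e] :> S.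
Proof.
by apply: (big_morph (fun m => 'X_[m] : S)) => [m m'|]; rewrite ?mpolyXD ?mpolyX0.
Qed.

Lemma mon_ideal_prod (s t : nat) (p q : S) :
  p \in mon_ideal (PU s) -> q \in mon_ideal (PU t) ->
  p * q \in mon_ideal (PU (s + t)).
Proof.
move=> /allP pU /allP qU; apply/allP => m /msuppM_le /allpairsP[[m1 m2] /=].
case=> /pU/power_upsetP[s1 [<- s1E s1m]] /qU/power_upsetP[s2 [<- s2E s2m]] ->.
apply/power_upsetP; exists (s1 ++ s2).
rewrite size_cat {1}/all_edges all_cat [all _ s1]s1E [all _ s2]s2E; split=> //.
rewrite /edges_mnm big_cat /=; apply/mnm_lepP => i.
by rewrite !mnmDE leq_add // (mnm_lepP s1m, mnm_lepP s2m).
Qed.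

Lemma edge_ideal_sub (p : S) : p \in edge_ideal D -> p \in mon_ideal (PU 1).
Proof.
move=> /asboolP[l lE ->]; rewrite big_seq; apply: rpred_sum => c /lE[u [v [Euv ->]]].
apply: submod_mull; rewrite Xv_edge; apply/allP => m.
rewrite msuppX inE => /eqP->; apply/power_upsetP; exists [:: (u, v)].
by rewrite /= Euv /edges_mnm big_seq1 lepm_refl.
Qed.

Lemma edge_ideal_gen u v : edge D u v ->
  'X_[edge_mnm (weight D) (u, v)] \in edge_ideal (k := k) D.
Proof.
move=> Euv; apply/asboolP; exists [:: (1, 'X_[edge_mnm (weight D) (u, v)])].
  by move=> c; rewrite inE => /eqP->; exists u, v; rewrite Xv_edge.
by rewrite big_seq1 mul1r.
Qed.

Lemma ideal_exp_sub t (p : S) :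
  p \in ideal_exp (edge_ideal D) t -> p \in mon_ideal (PU t).
Proof.
move=> /asboolP[l lE ->]; rewrite big_seq; apply: rpred_sum => c /lE[f fI ->].
apply: submod_mull => {c lE}; elim: t f fI => [|t IHt] f fI.
  apply/allP => m _; apply/power_upsetP; exists [::]; split=> //.
  by rewrite /edges_mnm big_nil; apply/mnm_lepP => i; rewrite mnm0E.
rewrite big_ord_recl; apply: (@mon_ideal_prod 1 t); first exact: edge_ideal_sub.
exact: IHt.
Qed.

Lemma ideal_exp_sup t (p : S) :
  p \in mon_ideal (PU t) -> p \in ideal_exp (edge_ideal D) t.
Proof.
move=> /allP pU; rewrite [p]mpolyE big_seq; apply: rpred_sum => m /pU.
move=> /power_upsetP[s [st sE sm]].
rewrite -(submK sm) mpolyXD scalerAl.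
apply: submod_mull.
apply/asboolP; exists [:: (1, 'X_[edges_mnm (weight D) s])];
  last by rewrite big_seq1 mul1r.
move=> c; rewrite inE => /eqP-> /=.
have sI e : e \in s -> 'X_[edge_mnm (weight D) e] \in edge_ideal (k := k) D.
  by case: e => u v /(allP sE); exact: edge_ideal_gen.
rewrite mpolyX_edges; subst t.
exists (fun i => 'X_[edge_mnm (weight D) (tnth (in_tuple s) i)]).
  by move=> i; apply: sI; apply: mem_tnth.
by rewrite -(big_tnth _ _ s predT (fun e => 'X_[edge_mnm (weight D) e])).
Qed.

(** Both sides describe the same module: the ideal power is spanned by the
    monomials divisible by a product of [t] edge monomials. *)
Lemma edge_ideal_power_pd e t :
  has_proj_resolution (edge_ideal_power k D t) e <-> pdU k e (PU t).
Proof.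
apply: iff_trans (has_proj_resolutionP _ _) _.
split; apply: submodule_iso => p; (exact: ideal_exp_sub || exact: ideal_exp_sup).
Qed.

End Bridge.

(** If neither [x -> v] nor [u -> y] is an edge, then the edges [x -> y] and
    [u -> v] are disjoint and form a gap. *)
Lemma gap_free_nested (T : finType) (D : wograph T) (X Y : {set T}) :
  gap_free D -> bipartition D X Y -> directed_from_to D X Y ->
  forall x y u v, edge D x y -> edge D u v -> edge D x v || edge D u y.
Proof.
move=> gapF [_ XY _] dir x y u v Exy Euv.
have XYF z : z \in X -> z \in Y -> False.
  by move=> zX zY; have := disjointFr XY zX; rewrite zY.
have [xX yY] := dir _ _ Exy; have [uX vY] := dir _ _ Euv.
apply: contraT; rewrite negb_or => /andP[nExv nEuy].
have := gapF x y u v; rewrite /gap {1 2}/adj Exy Euv /= => /negP[].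
have neq a b : a \in X -> b \in Y -> a != b.
  by move=> aX bY; apply: contraTneq aX => ->; apply/negP => /XYF; apply.
apply/andP; split.
  have nxu : x != u by apply: contraNneq nExv => ->.
  have nyv : y != v by apply: contraNneq nExv => <-.
  have nyu : y != u by rewrite eq_sym neq.
  rewrite disjoints_subset; apply/subsetP => z; rewrite !inE negb_or.
  by case/orP=> /eqP->; rewrite ?nxu ?nyu ?nyv ?(neq x v).
apply/negP => /exists_inP[a a_xy /exists_inP[b b_uv]].
move: a_xy b_uv; rewrite !inE /adj => /orP[]/eqP-> /orP[]/eqP->.
- by case/orP=> /dir[_]; apply: XYF.
- by rewrite (negbTE nExv) /= => /dir[vX _]; apply: XYF vX vY.
- by rewrite (negbTE nEuy) orbF => /dir[yX _]; apply: XYF yX yY.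
- by case/orP=> /dir[zX _]; apply: XYF zX _.
Qed.

Lemma coprod_edgeP (I : finType) (V : I -> finType)
    (D : forall i, wograph (V i)) p q :
  edge (coprod D) p q ->
  exists i x y, [/\ p = Tagged V x, q = Tagged V y & edge (D i) x y].
Proof.
case: p q => [i x] [j y] /=; rewrite /coprod_edge /= => /andP[/eqP ij].
case: j / ij y => y; rewrite tagged_asE => Exy.
by exists i, x, y.
Qed.

Lemma coprod_edge_Tagged (I : finType) (V : I -> finType)
    (D : forall i, wograph (V i)) i (x y : V i) :
  edge (coprod D) (Tagged V x) (Tagged V y) = edge (D i) x y.
Proof. by rewrite /= /coprod_edge /= eqxx tagged_asE. Qed.

Lemma class_rank_no_isolated (T I : finType) (L : T -> I) (E : rel T) :
  (forall v, touched E v) -> (forall c, exists v, L v = c) ->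
  class_rank L E = (#|T| - #|I|)%N.
Proof.
move=> vT L_surj; have -> : #|T| = (\sum_c #|[set v | L v == c]|)%N.
  rewrite -sum1_card (partition_big L predT) //=; apply: eq_bigr => c _.
  by rewrite -sum1dep_card.
rewrite -[#|I|]sum1_card -sumnB => [|c _]; last first.
  by have [v vc] := L_surj c; apply/card_gt0P; exists v; rewrite inE vc.
apply: eq_bigr => c _; rewrite subn1; congr (_.-1); apply: eq_card => v.
by rewrite !inE vT andbT.
Qed.

Local Close Scope ring_scope.

Theorem corollary1p2 (k : fieldType) (s : nat) (hs : 0 < s)
    (V : 'I_s -> finType) (D : forall i : 'I_s, wograph (V i))
    (X Y : forall i : 'I_s, {set V i})
    (hD : forall i : 'I_s, standing_assumptions (D i))
    (hgap : forall i : 'I_s, gap_free (D i))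
    (hbip : forall i : 'I_s, bipartition (D i) (X i) (Y i))
    (hdir : forall i : 'I_s, directed_from_to (D i) (X i) (Y i))
    (t0 : nat) (ht0 : 1 <= t0)
    (hpd : projdim_is (edge_ideal_power k (coprod D) t0)
                      (#|{: {i : 'I_s & V i}}| - s - 1)) :
  forall t : nat, t0 <= t ->
    projdim_is (edge_ideal_power k (coprod D) t)
               (#|{: {i : 'I_s & V i}}| - s - 1).
Proof.
set G := coprod D.
have bip : sources_to_sinks (edge G).
  move=> p q r /coprod_edgeP[i [x [y [_ -> Exy]]]]; apply/negP.
  case: r => j z Eyz; have /andP[/eqP /= ij _] := Eyz.
  case: j / ij z Eyz => z; rewrite coprod_edge_Tagged => Eyz.
  have [_ yY] := hdir i x y Exy; have [yX _] := hdir i y z Eyz.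
  by have [_ XY _] := hbip i; have := disjointFr XY yX; rewrite yY.
have lab : within_classes (@tag _ V) (edge G).
  by move=> p q /coprod_edgeP[i [x [y [-> ->]]]].
have nest : nested (@tag _ V) (edge G).
  move=> p q p' q' /coprod_edgeP[i [x [y [-> -> Exy]]]].
  move=> /coprod_edgeP[j [u [v [-> -> Euv]]]] ij; have {}ij : i = j := ij.
  case: j / ij u v Euv => u v Euv; rewrite !coprod_edge_Tagged.
  exact: (gap_free_nested (hgap i) (hbip i) (hdir i)).
have rankE : class_rank (@tag _ V) (edge G) = (#|{: {i : 'I_s & V i}}| - s)%N.
  rewrite class_rank_no_isolated ?card_ord // => [[i x]|i].
    have [_ /(_ x) + _] := hD i.
    rewrite negb_forall => /existsP[y]; rewrite negbK => xy.
    by apply/existsP; exists (Tagged V y); rewrite !coprod_edge_Tagged; apply: xy.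
  by have [[x _] _ _] := hD i; exists (Tagged V x).
have [x0 [y0 Exy0]] : exists x y, edge G x y.
  pose i := Ordinal hs; have [[x [y Exy]] _ _] := hD i.
  by exists (Tagged V x), (Tagged V y); rewrite coprod_edge_Tagged.
have [x [y rev]] := cancellable_edge_exists lab nest Exy0.
move=> t le_t0t; split=> [|e /edge_ideal_power_pd e_pd].
  apply/edge_ideal_power_pd; rewrite -rankE subn1.
  by apply: pdU_power_le => //; exact: weight_gt0.
(* A resolution of the power [t] yields one of the power [t0] of the same length,
   for which the lower bound is known. *)
apply: hpd.2; apply/edge_ideal_power_pd.
move: e_pd; rewrite -(subnK le_t0t); elim: (t - t0)%N => // d IHd e_pd.
exact/IHd/(pdU_power_descend bip rev).
Qed.
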